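(* Let $d\in\mathbb{C}$ with $d\ne0,-1,-2,\dots$, and let $n,\nu\in\mathbb{N}_0$. Then $$\sum_{k=0}^{n}\frac{(-1)^k}{2^k(k+1)}\binom nk\binom{2k}{k}\frac{\binom{k+d}{k}}{\binom{k+d-1}{k}}=\begin{cases}\dfrac{\left(\frac12\right)_\nu}{(1)_\nu}, & n=2\nu,\\[2ex] \dfrac12\left(1-\dfrac1d\right)\dfrac{\left(\frac32\right)_\nu}{(2)_\nu}, & n=2\nu+1.\end{cases}$$
   Context: $\mathbb{N}_0=\{0,1,2,\dots\}$. The Pochhammer symbol is $(\alpha)_0=1$, $(\alpha)_m=\alpha(\alpha+1)\cdots(\alpha+m-1)$ for $m\ge1$. Binomial coefficients with non-integer upper entry are generalized binomial coefficients; explicitly, for $k\in\mathbb{N}_0$, $\binom{k+d}{k}=\frac{(d+1)_k}{k!}$ and $\binom{k+d-1}{k}=\frac{(d)_k}{k!}$. *)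

(* Defs.v *)
From HB Require Import structures.
From mathcomp Require Import all_boot all_order all_algebra.
From mathcomp Require Import reals complex.

Set Implicit Arguments.
Unset Strict Implicit.
Unset Printing Implicit Defensive.

Import GRing.Theory.
Local Open Scope ring_scope.

Definition pochhammer (F : fieldType) (a : F) (m : nat) : F :=
  \prod_(i < m) (a + i%:R).

Definition gbinomial (F : fieldType) (x : F) (k : nat) : F :=
  (\prod_(i < k) (x - i%:R)) / k`!%:R.

Lemma gbinomial_pochhammer (F : fieldType) (x : F) (k : nat) :
  gbinomial (k%:R + x) k = pochhammer (x + 1) k / k`!%:R.
Proof.
rewrite /gbinomial /pochhammer (reindex_inj rev_ord_inj) /=.
congr (_ / _); apply: eq_bigr => i _.
by rewrite natrB // opprB addrC addrA subrK -natr1 addrC -addrA [1 + _]addrC.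
Qed.

Lemma gbinomial_pochhammer1 (F : fieldType) (x : F) (k : nat) :
  gbinomial (k%:R + x - 1) k = pochhammer x k / k`!%:R.
Proof. by rewrite -addrA gbinomial_pochhammer subrK. Qed.

(* Main.v *)
Require Import Defs.
From HB Require Import structures.
From mathcomp Require Import all_boot all_order all_algebra.
From mathcomp Require Import reals complex.
From mathcomp Require Import ring.

Set Implicit Arguments.
Unset Strict Implicit.
Unset Printing Implicit Defensive.

Import GRing.Theory.
Local Open Scope ring_scope.

(** The sum is an affine function of [1 / d], because
    [gbinomial (k + d) k / gbinomial (k + d - 1) k = (d)_(k+1) / (d (d)_k)],
    which is [1 + k / d]; together with
    [k / (k + 1) * 'C(2k, k) = 'C(2k, k + 1)] this turns the summand into
    [(-1/2) ^ k 'C(n, k) ('C(2k, k) - (1 - 1/d) 'C(2k, k + 1))]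
    ([summand_split]).  So it remains to evaluate, for [j = 0] and [j = 1],
    the sum of the [(-1/2) ^ k 'C(n, k) 'C(2k, k + j)].

    Since ['C(2k, k + j)] is the coefficient of ['X^(n + j)] in
    ['X^(n - k) (1 + 'X) ^ 2k], the binomial theorem shows that this sum is the
    coefficient of ['X^(n + j)] in
    [('X - (1 + 'X) ^ 2 / 2) ^ n = (-1/2) ^ n (1 + 'X^2) ^ n]
    ([binomial_sum_coef]).  The right-hand side is even: for even [n] only
    [j = 0] contributes, for odd [n] only [j = 1], and in each case the
    result is a power of [1/2] times a middle binomial coefficient, that is,
    a quotient of Pochhammer symbols ([central_bin_pochhammer],
    [odd_central_bin_pochhammer]). *)

Lemma coef_1DX_exp (F : fieldType) (m i : nat) :
  ((1 + 'X) ^+ m : {poly F})`_i = 'C(m, i)%:R.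
Proof.
rewrite addrC exprD1n coef_sum.
under eq_bigr => k _ do rewrite coefMn coefXn.
case: (ltnP i m.+1) => [lt_im | lt_mi].
  rewrite (bigD1 (Ordinal lt_im)) //= eqxx big1 ?addr0 // => k ne_ki.
  case: eqP => [e | _]; last by rewrite mul0rn.
  by case/eqP: ne_ki; apply: val_inj.
rewrite bin_small // big1 // => k _; case: eqP => [e|]; last by rewrite mul0rn.
by move: (ltn_ord k); rewrite -e ltnNge lt_mi.
Qed.

Lemma coef_1DX2_exp (F : fieldType) (m i : nat) :
  ((1 + 'X^2) ^+ m : {poly F})`_i = if odd i then 0 else 'C(m, i./2)%:R.
Proof.
have -> : (1 + 'X^2) ^+ m = ((1 + 'X) ^+ m) \Po 'X^2 :> {poly F}.
  by rewrite rmorphXn rmorphD rmorph1 /= comp_polyX.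
by rewrite coef_comp_poly_Xn // dvdn2 divn2 coef_1DX_exp; case: (odd i).
Qed.

(** Both sides are the coefficient of ['X^(n + j)] in
    [('X - (1 + 'X) ^ 2 / 2) ^ n]: the left one after expanding the power of the
    difference, the right one after cancelling the two terms ['X]. *)
Lemma binomial_sum_coef (F : numFieldType) (n j : nat) :
  \sum_(k < n.+1) (-1 / 2) ^+ k * 'C(n, k)%:R * 'C(2 * k, k + j)%:R
  = (-1 / 2) ^+ n * (if odd (n + j) then 0 else 'C(n, (n + j)./2)%:R) :> F.
Proof.
pose c : F := -1 / 2.
have key : 'X + c *: (1 + 'X) ^+ 2 = c *: (1 + 'X^2) :> {poly F}.
  have e : c + c = -1 by rewrite /c; field.
  have -> : (1 + 'X) ^+ 2 = (1 + 'X^2) + ('X + 'X) :> {poly F} by ring.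
  rewrite scalerDr [c *: ('X + 'X)]scalerDr -scalerDl e scaleN1r.
  by rewrite addrCA subrr addr0.
transitivity ((('X + c *: (1 + 'X) ^+ 2) ^+ n)`_(n + j)); last first.
  by rewrite key exprZn coefZ coef_1DX2_exp.
rewrite exprDn coef_sum; apply: eq_bigr => k _.
have le_kn : (k <= n)%N by rewrite -ltnS ltn_ord.
rewrite coefMn exprZn -scalerAr coefZ -exprM coefXnM.
have -> : (n + j < n - k)%N = false.
  by apply/negbTE; rewrite -leqNgt (leq_trans (leq_subr k n)) ?leq_addr.
have -> : (n + j - (n - k))%N = (k + j)%N.
  by rewrite addnC -addnBA ?leq_subr // subKn // addnC.
by rewrite coef_1DX_exp -[RHS]mulr_natr mulrAC.
Qed.

Lemma pochhammerS (F : fieldType) (a : F) (m : nat) :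
  pochhammer a m.+1 = pochhammer a m * (a + m%:R).
Proof. by rewrite /pochhammer big_ord_recr. Qed.

Lemma pochhammer_neq0 (F : fieldType) (a : F) (m : nat) :
  (forall i : nat, a != - i%:R) -> pochhammer a m != 0.
Proof.
by move=> ha; apply/prodf_neq0 => i _; rewrite addr_eq0.
Qed.

(** Both sides are [pochhammer a m.+1], with its first or its last factor split
    off. *)
Lemma pochhammer_shift (F : fieldType) (a : F) (m : nat) :
  a * pochhammer (a + 1) m = pochhammer a m * (a + m%:R).
Proof.
rewrite -pochhammerS /pochhammer big_ord_recl addr0; congr (_ * _).
by apply: eq_bigr => i _; rewrite -addrA nat1r.
Qed.

Lemma gbinomial_ratio (F : numFieldType) (d : F) (k : nat) :
  (forall m : nat, d != - m%:R) ->
  gbinomial (k%:R + d) k / gbinomial (k%:R + d - 1) k = 1 + k%:R / d.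
Proof.
move=> hd; rewrite gbinomial_pochhammer gbinomial_pochhammer1.
have d0 : d != 0 by have := hd 0; rewrite oppr0.
have p0 : pochhammer d k != 0 by exact: pochhammer_neq0.
have f0 : k`!%:R != 0 :> F by rewrite Num.Theory.pnatr_eq0 -lt0n fact_gt0.
have -> : pochhammer (d + 1) k = pochhammer d k * (d + k%:R) / d.
  by rewrite -pochhammer_shift mulrC mulKf.
by field; rewrite d0 p0 f0.
Qed.

Lemma summand_split (F : numFieldType) (d : F) (n k : nat) :
  (forall m : nat, d != - m%:R) ->
  (-1) ^+ k / (2 ^+ k * (k%:R + 1)) * 'C(n, k)%:R * 'C(2 * k, k)%:R
    * (gbinomial (k%:R + d) k / gbinomial (k%:R + d - 1) k)
  = (-1 / 2) ^+ k * 'C(n, k)%:R * 'C(2 * k, k + 0)%:R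
    - (1 - 1 / d) * ((-1 / 2) ^+ k * 'C(n, k)%:R * 'C(2 * k, k + 1)%:R).
Proof.
move=> hd; rewrite gbinomial_ratio // addn0 addn1.
have d0 : d != 0 by have := hd 0; rewrite oppr0.
have k0 : k%:R + 1 != 0 :> F by rewrite natr1 Num.Theory.pnatr_eq0.
have p0 : 2 ^+ k != 0 :> F by rewrite expf_neq0 // Num.Theory.pnatr_eq0.
have -> : 'C(2 * k, k.+1)%:R = k%:R / (k%:R + 1) * 'C(2 * k, k)%:R :> F.
  apply: (mulfI k0); rewrite mulrA mulrCA divff // mulr1 natr1 -!natrM.
  by rewrite mul_bin_left mul2n -addnn addnK.
by rewrite expr_div_n; field; rewrite d0 p0 k0.
Qed.

(** When [m] grows by one, ['C(2m, m)] is multiplied by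
    [2 (2m + 1) / (m + 1)]; after division by [4] this is the ratio
    [(1/2 + m) / (1 + m)] of the new factors of the Pochhammer symbols. *)
Lemma central_bin_pochhammer (F : numFieldType) (m : nat) :
  (1 / 2) ^+ (2 * m) * 'C(2 * m, m)%:R
  = pochhammer (1 / 2) m / pochhammer 1 m :> F.
Proof.
elim: m => [|m IH].
  by rewrite /pochhammer !big_ord0 muln0 bin0 expr0 mulr1 divr1.
have m0 : m%:R + 1 != 0 :> F by rewrite natr1 Num.Theory.pnatr_eq0.
have p0 : pochhammer 1 m != 0 :> F.
  by apply: pochhammer_neq0 => i; rewrite -addr_eq0 nat1r Num.Theory.pnatr_eq0.
have step : 'C(2 * m.+1, m.+1)%:R
    = 2 * (2 * m%:R + 1) / (m%:R + 1) * 'C(2 * m, m)%:R :> F.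
  have e1 : (m.+1 * 'C(2 * m.+1, m.+1) = 2 * (m.+1 * 'C((2 * m).+1, m)))%N.
    by rewrite -mul_bin_diag mulnS mulnA mulnS.
  have e2 : (m.+1 * 'C((2 * m).+1, m) = (2 * m).+1 * 'C(2 * m, m))%N.
    have := mul_bin_down (2 * m).+1 m.
    by rewrite subSn mul2n -addnn ?leq_addr // addnK => <-.
  rewrite e2 in e1; apply: (mulfI m0).
  rewrite [X in X * _ = _]natr1 -[LHS]natrM e1 !natrM.
  rewrite -[(2 * m).+1%:R]natr1 natrM.
  by field; rewrite m0.
rewrite step !pochhammerS mulnS exprD.
have -> : (1 / 2) ^+ 2 * (1 / 2) ^+ (2 * m)
    * (2 * (2 * m%:R + 1) / (m%:R + 1) * 'C(2 * m, m)%:R)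
  = (1 / 2 + m%:R) / (1 + m%:R) * ((1 / 2) ^+ (2 * m) * 'C(2 * m, m)%:R) :> F.
  by field; rewrite [1 + _]addrC m0.
by rewrite IH; field; rewrite p0 [1 + _]addrC m0.
Qed.

(** Reduces to [central_bin_pochhammer] at [m + 1], as
    ['C(2m + 2, m + 1) = 2 'C(2m + 1, m + 1)]. *)
Lemma odd_central_bin_pochhammer (F : numFieldType) (m : nat) :
  (1 / 2) ^+ (2 * m + 1) * 'C(2 * m + 1, m.+1)%:R
  = 1 / 2 * (pochhammer (3 / 2) m / pochhammer 2 m) :> F.
Proof.
have := central_bin_pochhammer F m.+1.
have -> : 'C(2 * m.+1, m.+1) = (2 * 'C(2 * m + 1, m.+1))%N.
  have e : 'C(2 * m + 1, m.+1) = 'C(2 * m + 1, m).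
    rewrite -bin_sub; last by rewrite addn1 ltnS mul2n -addnn leq_addr.
    by congr 'C(_, _); rewrite addn1 subSS mul2n -addnn addnK.
  by rewrite mulnS addnC addn2 binS -addn1 -e addnn -mul2n.
rewrite !pochhammerS -!pochhammer_shift.
have -> : 1 / 2 + 1 = 3 / 2 :> F by field.
rewrite -[1 + 1]/(2 : F) [1 * pochhammer 2 m]mul1r => e.
have -> : 1 / 2 * (pochhammer (3 / 2) m / pochhammer 2 m)
  = 1 / 2 * pochhammer (3 / 2) m / pochhammer 2 m :> F by rewrite mulrA.
rewrite -e mulnS addnC natrM !exprD expr1.
by field.
Qed.

Theorem theorem5p1 (R : realType) (d : R[i])
  (hd : forall m : nat, d != - m%:R) (n nu : nat) :
  let S : R[i] :=
    \sum_(0 <= k < n.+1)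
      (-1) ^+ k / (2 ^+ k * (k%:R + 1)) * 'C(n, k)%:R * 'C(2 * k, k)%:R
      * (gbinomial (k%:R + d) k / gbinomial (k%:R + d - 1) k) in
  (n = (2 * nu)%N ->
     S = pochhammer (1 / 2) nu / pochhammer 1 nu) /\
  (n = (2 * nu + 1)%N ->
     S = 1 / 2 * (1 - 1 / d) * (pochhammer (3 / 2) nu / pochhammer 2 nu)).
Proof.
move=> S.
have -> : S = (-1 / 2) ^+ n * (if odd (n + 0) then 0 else 'C(n, (n + 0)./2)%:R)
  - (1 - 1 / d)
    * ((-1 / 2) ^+ n * (if odd (n + 1) then 0 else 'C(n, (n + 1)./2)%:R)).
  rewrite -!binomial_sum_coef mulr_sumr -sumrB /S big_mkord.
  by apply: eq_bigr => k _; exact: summand_split.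
have sgn m : (-1 / 2) ^+ m = (-1) ^+ m * (1 / 2) ^+ m :> R[i].
  by rewrite -exprMn mulrA mulr1.
split=> ->.
  rewrite addn0 addn1 /= mul2n odd_double doubleK /= !mulr0 subr0 -mul2n.
  by rewrite sgn exprM sqrrN !expr1n mul1r central_bin_pochhammer.
have -> : (2 * nu + 1 + 1 = nu.+1.*2)%N by rewrite -addnA mul2n doubleS addn2.
rewrite addn0 addn1 /= oddM /= odd_double doubleK mulr0 sub0r.
rewrite sgn -signr_odd /= oddM /= expr1.
rewrite [in RHS]mulrAC -odd_central_bin_pochhammer addn1.
ring.
Qed.
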